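(* Let $N\ge 3$, $d\ge 2$, $1\le m\le N-2$, $n=N-m$, and $2\le K\le n$. The quantity $E_L^{n,\mathbf{r}}$ is invariant under local unitary transformations: for every unit vector $|\Phi_N\rangle\in(\mathbb{C}^d)^{\otimes N}$, every set $\mathbf{r}\subset\{1,\dots,N\}$ of $m$ measured parties, and all unitary operators $U_1,\dots,U_N$ on $\mathbb{C}^d$, $$E_L^{n,\mathbf{r}}\big((U_1\otimes U_2\otimes\cdots\otimes U_N)|\Phi_N\rangle\big)=E_L^{n,\mathbf{r}}(|\Phi_N\rangle).$$
   Context: All states are pure states (unit vectors) of systems whose parties each have Hilbert space $\mathbb{C}^d$. A unit vector in $(\mathbb{C}^d)^{\otimes n}$ is called $K$-separable if there is a partition of the $n$ parties into $K$ nonempty blocks such that the vector is a tensor product of $K$ vectors, one for each block. The $K$-separability based geometric measure (K-GM) of a unit vector $|\psi\rangle\in(\mathbb{C}^d)^{\otimes n}$, $2\le K\le n$, is $$G_K(|\psi\rangle)=1-\max_{|\phi\rangle\in\mathcal{S}_K}|\langle\phi|\psi\rangle|^2,$$ where $\mathcal{S}_K$ is the set of all $K$-separable unit vectors in $(\mathbb{C}^d)^{\otimes n}$. Localizable multipartite entanglement (LME): let $\mathbf{r}$ be a set of $m$ parties and $n=N-m\ge 2$. A complete set of local projectors on $\mathbf{r}$ is given by a choice, for each $j\in\mathbf{r}$, of an orthonormal basis of the space of party $j$; the $d^m$ outcomes $l$ are indexed by the product basis vectors $|\xi^l\rangle$ of $\bigotimes_{j\in\mathbf{r}}\mathbb{C}^d$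 and $P^l=|\xi^l\rangle\langle\xi^l|\otimes\mathbb{I}$, with $\mathbb{I}$ the identity on the remaining $n$ parties. The outcome $l$ has probability $p^l=\langle\Phi_N|P^l|\Phi_N\rangle$, and when $p^l>0$ the post-measurement state is $P^l|\Phi_N\rangle/\sqrt{p^l}=|\xi^l\rangle\otimes|\psi_n^l\rangle$, where $|\psi^l_n\rangle$ is the resulting unit vector of the $n$ unmeasured parties. Then $$E_L^{n,\mathbf{r}}(|\Phi_N\rangle)=\sup_{\{P^l\}}\sum_{l=1}^{d^m}p^l\,G_K(|\psi_n^l\rangle),$$ the supremum being over all complete sets of local projectors on $\mathbf{r}$ (outcomes with $p^l=0$ contribute $0$). *)

(* Defs.v *)
From HB Require Import structures.
From mathcomp Require Import all_boot all_order all_algebra.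
From mathcomp Require Import spectral.
From mathcomp Require Import complex.
From mathcomp Require Import boolp classical_sets reals.

Set Implicit Arguments.
Unset Strict Implicit.
Unset Printing Implicit Defensive.

Import Order.TTheory GRing.Theory Num.Theory.
Local Open Scope ring_scope.
Local Open Scope complex_scope.

(* The parties form a finite type I. (C^d)^{(x) I} is modelled by its
   coordinates in the computational product basis, which is indexed by
   {ffun I -> 'I_d}. *)
Definition idx (I : finType) (d : nat) : finType := {ffun I -> 'I_d}.

Definition qudit (R : realType) (d : nat) := {ffun 'I_d -> R[i]}.

Definition state (R : realType) (I : finType) (d : nat) :=
  {ffun idx I d -> R[i]}.

(* Subsystem of the parties in A *)
Definition party (I : finType) (A : {set I}) : finType := {i : I | i \in A}.

Definition restr (I : finType) (d : nat) (A : {set I}) (x : idx I d) :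
  idx (party A) d := [ffun i => x (val i)].

(* Conjugate-linear in the first argument; used both for a single party
   (X = 'I_d) and for several parties (X = idx I d). *)
Definition braket (R : realType) (X : finType) (f g : {ffun X -> R[i]}) : R[i] :=
  \sum_x (f x)^* * g x.

Definition unit_vector (R : realType) (X : finType) (f : {ffun X -> R[i]}) : Prop :=
  braket f f = 1.

Definition sqmod (R : realType) (z : R[i]) : R := Normc.normc z ^+ 2.

(* Operators on (C^d)^{(x) I}, as matrices in the computational basis *)
Definition operator (R : realType) (I : finType) (d : nat) :=
  idx I d -> idx I d -> R[i].

Definition app (R : realType) (I : finType) (d : nat)
    (T : operator R I d) (psi : state R I d) : state R I d :=
  [ffun x => \sum_y T x y * psi y].

Definition tensor_op (R : realType) (I : finType) (d : nat)
    (U : I -> 'M[R[i]]_d) : operator R I d :=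
  fun x y => \prod_i U i (x i) (y i).

(* Reordering-free bipartite tensor product: xi on A, psi on its complement *)
Definition tens (R : realType) (I : finType) (d : nat) (A : {set I})
    (xi : state R (party A) d) (psi : state R (party (~: A)) d) : state R I d :=
  [ffun x => xi (restr A x) * psi (restr (~: A) x)].

Definition K_separable (R : realType) (I : finType) (d K : nat)
    (phi : state R I d) : Prop :=
  exists (P : {set {set I}}) (v : forall B : {set I}, state R (party B) d),
    [/\ finset.partition P [set: I], #|P| = K &
        forall x : idx I d, phi x = \prod_(B in P) v B (restr B x)].

Definition separable_states (R : realType) (I : finType) (d K : nat) :
  set (state R I d) :=
  [set phi | unit_vector phi /\ K_separable K phi]%classic.

(* The set of K-separable unit vectors is compact, so this supremum is the
   maximum. *)
Definition GM (R : realType) (I : finType) (d K : nat) (psi : state R I d) : R :=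
  1 - sup [set sqmod (braket phi psi) | phi in @separable_states R I d K]%classic.

(* d orthonormal vectors in C^d *)
Definition orthonormal_basis (R : realType) (d : nat) (b : 'I_d -> qudit R d) : Prop :=
  forall k l, braket (b k) (b l) = (k == l)%:R.

(* A measurement setting on the parties in r: one basis for each of them. *)
Definition setting (R : realType) (I : finType) (d : nat) (r : {set I}) :=
  party r -> 'I_d -> qudit R d.

Definition local_measurement (R : realType) (I : finType) (d : nat) (r : {set I})
    (b : setting R d r) : Prop :=
  forall j, orthonormal_basis (b j).

Definition product_vector (R : realType) (I : finType) (d : nat) (r : {set I})
    (b : setting R d r) (l : idx (party r) d) : state R (party r) d :=
  [ffun y : idx (party r) d => \prod_j b j (l j) (y j)].

(* |xi><xi| (x) Id, the identity acting on the parties outside r *)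
Definition projector (R : realType) (I : finType) (d : nat) (r : {set I})
    (xi : state R (party r) d) : operator R I d :=
  fun x y => xi (restr r x) * (xi (restr r y))^*
             * (restr (~: r) x == restr (~: r) y)%:R.

(* <Phi|P|Phi> is real since P is Hermitian. *)
Definition prob (R : realType) (I : finType) (d : nat) (r : {set I})
    (xi : state R (party r) d) (Phi : state R I d) : R :=
  complex.Re (braket Phi (app (projector xi) Phi)).

(* (<xi| (x) Id)|Phi> / sqrt p: the factor psi of P|Phi>/sqrt p = xi (x) psi, see
   projector_post_state. It is 0 when p = 0. *)
Definition post_state (R : realType) (I : finType) (d : nat) (r : {set I})
    (xi : state R (party r) d) (Phi : state R I d) : state R (party (~: r)) d :=
  [ffun z : idx (party (~: r)) d =>
     ((Num.sqrt (prob xi Phi))^-1)%:C *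
     \sum_(y : idx I d | restr (~: r) y == z) (xi (restr r y))^* * Phi y].

Lemma projector_post_state (R : realType) (I : finType) (d : nat) (r : {set I})
    (xi : state R (party r) d) (Phi : state R I d) (x : idx I d) :
  ((Num.sqrt (prob xi Phi))^-1)%:C * app (projector xi) Phi x
  = tens xi (post_state xi Phi) x.
Proof.
rewrite !ffunE mulrCA; congr (_ * _).
rewrite [in RHS]big_mkcond mulr_sumr; apply: eq_bigr => y _.
rewrite /projector eq_sym; case: eqP => _; last by rewrite mulr0 mul0r mulr0.
by rewrite mulr1 mulrA.
Qed.

Lemma product_vector_unit (R : realType) (I : finType) (d : nat) (r : {set I})
    (b : setting R d r) (l : idx (party r) d) :
  local_measurement b -> unit_vector (product_vector b l).
Proof.
move=> hb; rewrite /unit_vector /braket.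
transitivity (\prod_(j : party r) \sum_(k < d) (b j (l j) k)^* * b j (l j) k).
  rewrite bigA_distr_bigA; apply: eq_bigr => y _.
  by rewrite ffunE rmorph_prod -big_split.
by apply: big1 => j _; have := hb j (l j) (l j); rewrite eqxx.
Qed.

(* Average K-GM of the post-measurement states; outcomes of probability 0
   contribute 0. *)
Definition average_GM (R : realType) (I : finType) (d K : nat) (r : {set I})
    (b : setting R d r) (Phi : state R I d) : R :=
  \sum_(l : idx (party r) d)
    prob (product_vector b l) Phi * GM K (post_state (product_vector b l) Phi).

Definition LME (R : realType) (I : finType) (d K : nat) (r : {set I})
    (Phi : state R I d) : R :=
  sup [set average_GM K b Phi | b in @local_measurement R I d r]%classic.

(* Main.v *)
(* A local unitary maps the K-separable unit vectors onto themselves and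
   preserves overlaps, so the K-GM is invariant under local unitaries.
   Rotating each measurement basis vector along with the state preserves the
   outcome probabilities and rotates the post-measurement states by a local
   unitary. Hence every average over outcomes attained for Phi is attained for
   U Phi; applying this to the adjoints of the U_j gives the converse, and the
   two suprema are over the same set. *)
Require Import Defs.
From mathcomp Require Import classical_sets.
From mathcomp Require Import all_boot all_order all_algebra.
From mathcomp Require Import spectral complex reals.
From mathcomp Require Import sesquilinear.

Local Open Scope ring_scope.
Local Open Scope complex_scope.

Set Implicit Arguments.
Unset Strict Implicit.
Unset Printing Implicit Defensive.

Import Order.TTheory GRing.Theory Num.Theory.

(** * Splitting product-basis indices along subsets and partitions of the parties *)

Lemma notin_setC (I : finType) (A : {set I}) (i : I) :
  ~ i \in A -> i \in ~: A.
Proof. by move/negP; rewrite inE. Qed.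

(** Inverse of the pair of restrictions to [A] and [~: A]. Matching on [decP] keeps the membership
    proof, from which the element of the subtype is built. *)
Definition glue (I : finType) (d : nat) (A : {set I})
    (w : idx (party A) d) (z : idx (party (~: A)) d) : idx I d :=
  [ffun i => match decP (@idP (i \in A)) with
             | left h => w (exist _ i h)
             | right h => z (exist _ i (notin_setC h))
             end].

Lemma restr_gluel (I : finType) (d : nat) (A : {set I})
    (w : idx (party A) d) (z : idx (party (~: A)) d) :
  restr A (glue w z) = w.
Proof.
apply/ffunP => -[i hi]; rewrite !ffunE /=.
case: decP => h; last by case: h.
by congr (w _); apply: val_inj.
Qed.

Lemma restr_gluer (I : finType) (d : nat) (A : {set I})
    (w : idx (party A) d) (z : idx (party (~: A)) d) :
  restr (~: A) (glue w z) = z.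
Proof.
apply/ffunP => -[i hi]; rewrite !ffunE /=.
case: decP => h; first by have := finset.setCP hi.
by congr (z _); apply: val_inj.
Qed.

Lemma glue_restr (I : finType) (d : nat) (A : {set I}) (x : idx I d) :
  glue (restr A x) (restr (~: A) x) = x.
Proof. by apply/ffunP => i; rewrite ffunE; case: decP => h; rewrite ffunE. Qed.

Lemma glue_in (I : finType) (d : nat) (A : {set I}) (x : idx I d)
    (z : idx (party (~: A)) d) (i : I) :
  i \in A -> glue (restr A x) z i = x i.
Proof.
move=> hi; have := congr1 (fun f : idx _ _ => f (exist _ i hi))
  (restr_gluel (restr A x) z).
by rewrite !ffunE.
Qed.

Lemma sum_glue (V : nmodType) (I : finType) (d : nat) (A : {set I})
    (F : idx I d -> V) :
  \sum_y F y = \sum_w \sum_z F (glue (A := A) w z).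
Proof.
rewrite pair_bigA /=.
apply: (reindex (fun p => glue p.1 p.2)).
exists (fun y => (restr A y, restr (~: A) y)) => [[w z]|y] _ /=.
  by rewrite restr_gluel restr_gluer.
exact: glue_restr.
Qed.

(** Distributivity: an index of all parties amounts to one index for each block. General
    distributivity sums over functions into a single type, whereas here the index type varies with
    the block; so block indices are padded to full ones, with the values of [x0] outside the
    block. *)
Lemma sum_prod_partition (R : comNzRingType) (I : finType) (d : nat)
    (P : {set {set I}}) (F : forall B : {set I}, idx (party B) d -> R)
    (x0 : idx I d) :
  partition P [set: I] ->
  \sum_(y : idx I d) \prod_(B in P) F B (restr B y)
  = \prod_(B in P) \sum_w F B w.
Proof.
move=> /and3P[/eqP covP trivP _].
have inP i : i \in cover P by rewrite covP inE.
pose ext B (w : idx (party B) d) := glue w (restr (~: B) x0).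
pose join (f : {ffun {set I} -> idx I d}) : idx I d :=
  [ffun i => f (pblock P i) i].
pose spread (y : idx I d) : {ffun {set I} -> idx I d} :=
  [ffun B => if B \in P then ext B (restr B y) else x0].
have spreadK y : join (spread y) = y.
  apply/ffunP => i; rewrite !ffunE pblock_mem // /ext glue_in //.
  by rewrite mem_pblock.
have restr_join B f : B \in P -> restr B (join f) = restr B (f B).
  move=> BP; apply/ffunP => -[i hi]; rewrite !ffunE /=.
  by rewrite (def_pblock trivP BP hi).
(* The padded indices of [B] are exactly the fixed points of restricting to [B] and padding again,
   so every factor becomes a sum over the one type [idx I d]. *)
transitivity (\prod_(B in P)
    \sum_(h : idx I d | ext B (restr B h) == h) F B (restr B h)); last first.
  apply: eq_bigr => B _; rewrite [RHS](reindex_onto (@restr I d B) (ext B)) //.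
  by move=> w _; rewrite /ext restr_gluel.
rewrite (big_distr_big_dep x0) (reindex_onto join spread) //.
apply: eq_big => [f|f _]; last first.
  by apply: eq_bigr => B BP; rewrite restr_join.
(* [spread] inverts [join] exactly on the families that take the default [x0] off [P] and a padded
   index at each block of [P]. *)
apply/eqP/pfamilyP => [eq_f|[suppf famf]].
  split=> [|B BP].
    by apply/subsetP => B; apply: contraR => BP; rewrite -eq_f ffunE (negPf BP).
  by rewrite unfold_in -restr_join // -{2}eq_f ffunE BP.
apply/ffunP => B; rewrite ffunE; case: ifPn => BP.
  by rewrite restr_join //; apply/eqP; exact: famf.
by apply/esym/eqP; apply: contraR BP => /(subsetP suppf).
Qed.

(** * Isometries and tensor products of unitaries *)

(** The identity $T^*T=1$ in coordinates; a general [X] serves both a single party and a whole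
    system. *)
Definition isometry (R : realType) (X : finType) (T : X -> X -> R[i]) : Prop :=
  forall y y', \sum_x (T x y)^* * T x y' = (y == y')%:R.

Lemma sum_delta (R : nzRingType) (X : finType) (y : X) (f : X -> R) :
  \sum_z (y == z)%:R * f z = f y.
Proof.
rewrite (bigD1 y) //= eqxx mul1r big1 ?addr0 // => z /negPf.
by rewrite eq_sym => ->; rewrite mul0r.
Qed.

Lemma braket_isometry (R : realType) (X : finType) (T : X -> X -> R[i])
    (f g : {ffun X -> R[i]}) :
  isometry T ->
  braket [ffun x => \sum_y T x y * f y] [ffun x => \sum_y T x y * g y]
  = braket f g.
Proof.
move=> isoT; rewrite /braket.
transitivity (\sum_x \sum_y \sum_z (f y)^* * g z * ((T x y)^* * T x z)).
  apply: eq_bigr => x _; rewrite !ffunE rmorph_sum mulr_suml.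
  apply: eq_bigr => y _; rewrite mulr_sumr; apply: eq_bigr => z _.
  by rewrite rmorphM /= mulrACA mulrC.
rewrite exchange_big; apply: eq_bigr => y _; rewrite exchange_big /=.
transitivity (\sum_z (y == z)%:R * ((f y)^* * g z)); last exact: sum_delta.
by apply: eq_bigr => z _; rewrite -mulr_sumr isoT mulrC.
Qed.

Local Open Scope sesquilinear_scope.

(** [unitarymx] means $UU^*=1$; the identity $U^*U=1$ comes from applying it to the adjoint. *)
Lemma unitary_isometry (R : realType) (d : nat) (U : 'M[R[i]]_d) :
  U \is unitarymx -> isometry U.
Proof.
rewrite -trmxC_unitary => /unitarymxP; rewrite trmxCK => eq1 y y'.
have := congr1 (fun M : 'M_d => M y y') eq1; rewrite !mxE => <-.
by apply: eq_bigr => x _; rewrite !mxE.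
Qed.

(** The sum over product indices factors into one sum per party, each a Kronecker delta. *)
Lemma tensor_op_isometry (R : realType) (I : finType) (d : nat)
    (U : I -> 'M[R[i]]_d) :
  (forall i, U i \is unitarymx) -> isometry (tensor_op U).
Proof.
move=> hU y y'.
transitivity (\prod_i \sum_(k < d) (U i k (y i))^* * U i k (y' i)).
  rewrite bigA_distr_bigA; apply: eq_bigr => x _.
  by rewrite /tensor_op rmorph_prod -big_split.
rewrite (eq_bigr (fun i => (y i == y' i)%:R)); last first.
  by move=> i _; exact: unitary_isometry.
have [->|neq] := eqVneq y y'; first by apply: big1 => i _; rewrite eqxx.
have [i neqi|eq_y] := pickP (fun i => y i != y' i).
  by rewrite (bigD1 i) //= (negPf neqi) mul0r.
by case/eqP: neq; apply/ffunP => i; have /negbFE/eqP := eq_y i.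
Qed.

Lemma braket_tensor_op (R : realType) (I : finType) (d : nat)
    (U : I -> 'M[R[i]]_d) (f g : state R I d) :
  (forall i, U i \is unitarymx) ->
  braket (app (tensor_op U) f) (app (tensor_op U) g) = braket f g.
Proof. by move=> hU; apply: braket_isometry; exact: tensor_op_isometry. Qed.

Lemma tensor_op_adjK (R : realType) (I : finType) (d : nat)
    (U : I -> 'M[R[i]]_d) (f : state R I d) :
  (forall i, U i \is unitarymx) ->
  app (tensor_op (fun i => (U i)^t*)) (app (tensor_op U) f) = f.
Proof.
move=> hU; apply/ffunP => x; rewrite ffunE.
transitivity (\sum_y \sum_z (tensor_op U y x)^* * tensor_op U y z * f z).
  apply: eq_bigr => y _; rewrite ffunE mulr_sumr; apply: eq_bigr => z _.
  rewrite mulrA; congr (_ * _ * _); rewrite /tensor_op rmorph_prod.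
  by apply: eq_bigr => i _; rewrite !mxE.
rewrite exchange_big /= -[RHS](sum_delta x f); apply: eq_bigr => z _.
by rewrite -mulr_suml tensor_op_isometry.
Qed.

Lemma app_scale (R : realType) (I : finType) (d : nat) (T : operator R I d)
    (c : R[i]) (f : state R I d) :
  app T [ffun x => c * f x] = [ffun x => c * app T f x].
Proof.
apply/ffunP => x; rewrite !ffunE mulr_sumr; apply: eq_bigr => y _.
by rewrite ffunE mulrCA.
Qed.

Lemma tensor_op_block (R : realType) (I : finType) (d : nat)
    (U : I -> 'M[R[i]]_d) (A : {set I}) (x y : idx I d) :
  \prod_(i in A) U i (x i) (y i)
  = tensor_op (fun j : party A => U (val j)) (restr A x) (restr A y).
Proof. by rewrite big_sub; apply: eq_bigr => j _; rewrite !ffunE. Qed.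

Lemma tensor_op_glue (R : realType) (I : finType) (d : nat)
    (U : I -> 'M[R[i]]_d) (A : {set I})
    (w w' : idx (party A) d) (z z' : idx (party (~: A)) d) :
  tensor_op U (glue w z) (glue w' z')
  = tensor_op (fun j : party A => U (val j)) w w'
    * tensor_op (fun j : party (~: A) => U (val j)) z z'.
Proof.
rewrite {1}/tensor_op (bigID (mem A)) /= tensor_op_block !restr_gluel.
rewrite (eq_bigl (mem (~: A))); last by move=> i; rewrite !inE.
by rewrite tensor_op_block !restr_gluer.
Qed.

(** * Invariance of K-separability and of the K-GM *)

(** The operator factors over the blocks of the partition, so the same partition works, each block
    vector being rotated by the unitaries of its own parties. *)
Lemma K_separable_tensor_op (R : realType) (I : finType) (d K : nat)
    (U : I -> 'M[R[i]]_d) (phi : state R I d) :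
  K_separable K phi -> K_separable K (app (tensor_op U) phi).
Proof.
move=> [P [v [partP cardP phiE]]].
exists P, (fun B => app (tensor_op (fun j : party B => U (val j))) (v B)).
split=> // x; rewrite ffunE.
under [RHS]eq_bigr do rewrite ffunE.
rewrite -(sum_prod_partition (fun B w =>
  tensor_op (fun j : party B => U (val j)) (restr B x) w * v B w) x partP).
apply: eq_bigr => y _; rewrite phiE big_split /=; congr (_ * _).
transitivity (\prod_(i in [set: I]) U i (x i) (y i)).
  by apply: eq_bigl => i; rewrite inE.
rewrite (set_partition_big _ partP) /=.
by apply: eq_bigr => B _; exact: tensor_op_block.
Qed.

(** [psi] ranges over all vectors, so the zero [post_state] of an outcome of probability 0 is
    covered. *)
Lemma GM_tensor_op (R : realType) (I : finType) (d K : nat)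
    (U : I -> 'M[R[i]]_d) (psi : state R I d) :
  (forall i, U i \is unitarymx) ->
  GM K (app (tensor_op U) psi) = GM K psi.
Proof.
move=> hU; congr (1 - sup _).
pose overlaps (chi : state R I d) :=
  [set sqmod (braket phi chi) | phi in @separable_states R I d K]%classic.
have sub (V : I -> 'M[R[i]]_d) chi : (forall i, V i \is unitarymx) ->
    (overlaps chi `<=` overlaps (app (tensor_op V) chi))%classic.
  move=> hV _ [phi [unit_phi sep_phi] <-].
  exists (app (tensor_op V) phi); last by rewrite braket_tensor_op.
  split; last exact: K_separable_tensor_op.
  by rewrite /unit_vector braket_tensor_op.
apply/seteqP; split; last exact: sub.
(* Writing [psi] as the adjoint operator applied to its image turns the reverse inclusion into an
   instance of [sub]. *)
rewrite -[X in (_ `<=` overlaps X)%classic](tensor_op_adjK psi hU).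
by apply: sub => i; rewrite trmxC_unitary.
Qed.

(** * Outcome probabilities and post-measurement states through contraction *)

(* The unnormalized post-measurement state (<xi| (x) Id)|Phi>. *)
Definition contract (R : realType) (I : finType) (d : nat) (r : {set I})
    (xi : state R (party r) d) (Phi : state R I d) : state R (party (~: r)) d :=
  [ffun z => braket xi [ffun w => Phi (glue w z)]].

Lemma contractE (R : realType) (I : finType) (d : nat) (r : {set I})
    (xi : state R (party r) d) (Phi : state R I d) (z : idx (party (~: r)) d) :
  \sum_(y : idx I d | restr (~: r) y == z) (xi (restr r y))^* * Phi y
  = contract xi Phi z.
Proof.
rewrite ffunE /braket big_mkcond (sum_glue r); apply: eq_bigr => w _.
rewrite ffunE -big_mkcond (big_pred1 z) ?restr_gluel // => z'.
by rewrite restr_gluer.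
Qed.

(** The projector is $C^*C$ with $C=\langle\xi|\otimes\mathbb{I}$, so the probability is the squared
    norm of the contraction. *)
Lemma probE (R : realType) (I : finType) (d : nat) (r : {set I})
    (xi : state R (party r) d) (Phi : state R I d) :
  prob xi Phi = complex.Re (braket (contract xi Phi) (contract xi Phi)).
Proof.
congr complex.Re.
transitivity (\sum_x (Phi x)^* * (xi (restr r x)
    * contract xi Phi (restr (~: r) x))).
  apply: eq_bigr => x _; rewrite ffunE -contractE; congr (_ * _).
  rewrite mulr_sumr [in RHS]big_mkcond; apply: eq_bigr => y _.
  rewrite /projector eq_sym; case: eqP => _; last by rewrite mulr0 mul0r.
  by rewrite mulr1 mulrA.
rewrite (sum_glue r) exchange_big; apply: eq_bigr => z _ /=.
rewrite {2}/contract ffunE rmorph_sum mulr_suml; apply: eq_bigr => w _.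
by rewrite restr_gluel restr_gluer rmorphM /= conjCK !ffunE mulrA [_ * xi w]mulrC.
Qed.

Lemma post_stateE (R : realType) (I : finType) (d : nat) (r : {set I})
    (xi : state R (party r) d) (Phi : state R I d) :
  post_state xi Phi
  = [ffun z => ((Num.sqrt (prob xi Phi))^-1)%:C * contract xi Phi z].
Proof. by apply/ffunP => z; rewrite !ffunE contractE ffunE. Qed.

(** * Rotating the measurement together with the state *)

Section LocalUnitary.

Variables (R : realType) (I : finType) (d : nat) (r : {set I}).
Variables (U : I -> 'M[R[i]]_d) (hU : forall i, U i \is unitarymx).

(** The unitaries on [r] act on both sides of the inner product over [r] and cancel; those on the
    other parties remain. *)
Lemma contract_tensor_op (xi : state R (party r) d) (Phi : state R I d) :
  contract (app (tensor_op (fun j : party r => U (val j))) xi)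
           (app (tensor_op U) Phi)
  = app (tensor_op (fun j : party (~: r) => U (val j))) (contract xi Phi).
Proof.
apply/ffunP => z; rewrite [LHS]ffunE [RHS]ffunE.
set T := tensor_op (fun j : party (~: r) => U (val j)).
(* [g] is the slice at [z] of [Phi] with only the unmeasured parties rotated. *)
pose g := [ffun w : idx (party r) d => \sum_z' T z z' * Phi (glue w z')].
transitivity (braket xi g).
  rewrite -(@braket_tensor_op _ _ _ (fun j : party r => U (val j)) xi g) //.
  congr braket; apply/ffunP => w; rewrite !ffunE (sum_glue r).
  apply: eq_bigr => w' _; rewrite ffunE mulr_sumr; apply: eq_bigr => z' _.
  by rewrite tensor_op_glue mulrA.
rewrite /braket; under eq_bigr do rewrite ffunE mulr_sumr.
rewrite exchange_big; apply: eq_bigr => z' _.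
rewrite ffunE mulr_sumr; apply: eq_bigr => w _.
by rewrite ffunE mulrCA.
Qed.

Lemma prob_tensor_op (xi : state R (party r) d) (Phi : state R I d) :
  prob (app (tensor_op (fun j : party r => U (val j))) xi)
       (app (tensor_op U) Phi)
  = prob xi Phi.
Proof. by rewrite !probE contract_tensor_op braket_tensor_op. Qed.

Lemma post_state_tensor_op (xi : state R (party r) d) (Phi : state R I d) :
  post_state (app (tensor_op (fun j : party r => U (val j))) xi)
             (app (tensor_op U) Phi)
  = app (tensor_op (fun j : party (~: r) => U (val j))) (post_state xi Phi).
Proof.
by rewrite !post_stateE prob_tensor_op contract_tensor_op app_scale.
Qed.

Definition rotate (b : setting R d r) : setting R d r :=
  fun j k => [ffun x => \sum_y U (val j) x y * b j k y].

Lemma local_measurement_rotate (b : setting R d r) :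
  local_measurement b -> local_measurement (rotate b).
Proof.
move=> hb j k l; rewrite -(hb j k l); apply: braket_isometry.
exact: unitary_isometry.
Qed.

Lemma product_vector_rotate (b : setting R d r) (l : idx (party r) d) :
  product_vector (rotate b) l
  = app (tensor_op (fun j : party r => U (val j))) (product_vector b l).
Proof.
apply/ffunP => x; rewrite !ffunE.
under eq_bigr do rewrite ffunE.
rewrite bigA_distr_bigA; apply: eq_bigr => y _.
by rewrite ffunE big_split.
Qed.

Lemma average_GM_rotate (K : nat) (b : setting R d r) (Phi : state R I d) :
  average_GM K (rotate b) (app (tensor_op U) Phi) = average_GM K b Phi.
Proof.
apply: eq_bigr => l _.
by rewrite product_vector_rotate prob_tensor_op post_state_tensor_op GM_tensor_op.
Qed.

End LocalUnitary.

Lemma LME_tensor_op (R : realType) (I : finType) (d K : nat) (r : {set I})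
    (U : I -> 'M[R[i]]_d) (Phi : state R I d) :
  (forall i, U i \is unitarymx) ->
  LME K r (app (tensor_op U) Phi) = LME K r Phi.
Proof.
move=> hU; congr sup.
pose averages (Psi : state R I d) :=
  [set average_GM K b Psi | b in @local_measurement R I d r]%classic.
have sub (V : I -> 'M[R[i]]_d) Psi : (forall i, V i \is unitarymx) ->
    (averages Psi `<=` averages (app (tensor_op V) Psi))%classic.
  move=> hV _ [b hb <-]; exists (rotate V b); last exact: average_GM_rotate.
  exact: local_measurement_rotate.
apply/seteqP; split; last exact: sub.
(* As for the K-GM, the reverse inclusion is [sub] for the adjoints, applied to the rotated
   state. *)
rewrite -[X in (_ `<=` averages X)%classic](tensor_op_adjK Phi hU).
by apply: sub => i; rewrite trmxC_unitary.
Qed.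

Theorem theorem2 (R : realType) (N d m n K : nat)
    (hN : (3 <= N)%N) (hd : (2 <= d)%N) (hm : (1 <= m <= N - 2)%N)
    (hn : n = (N - m)%N) (hK : (2 <= K <= n)%N)
    (Phi : state R 'I_N d) (hPhi : unit_vector Phi)
    (r : {set 'I_N}) (hr : #|r| = m)
    (U : 'I_N -> 'M[R[i]]_d) (hU : forall j : 'I_N, U j \is unitarymx) :
  LME K r (app (tensor_op U) Phi) = LME K r Phi.
Proof. exact: LME_tensor_op. Qed.
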